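(* Let $f, g, m, u_1, u_2, v_1, v_2$ be arbitrary rational numbers, and define rational numbers $a_1,\ldots,a_5$ and $b_1,b_2,b_3$ by \[ \begin{aligned} a_1 & = 4\bigl(mu_1u_2(u_1v_1-u_2v_2)f^2-(u_1v_2-u_2v_1)(m^2u_1u_2v_1v_2-1)fg-mv_1v_2(u_1v_1-u_2v_2)g^2\bigr)^2,\\ a_2 & = 4\bigl(mu_1u_2(u_1v_1+u_2v_2)f^2+(u_1v_2+u_2v_1)(m^2u_1u_2v_1v_2+1)fg+mv_1v_2(u_1v_1+u_2v_2)g^2\bigr)^2,\\ a_3 & = \bigl((u_1^2u_2^2(v_1^2-v_2^2)m^2+u_1^2-u_2^2)f^2-(v_1^2v_2^2(u_1^2-u_2^2)m^2+v_1^2-v_2^2)g^2\bigr)^2,\\ a_4 & = 4\bigl(mu_1u_2(u_1v_1-u_2v_2)f^2+(u_1v_2-u_2v_1)(m^2u_1u_2v_1v_2-1)fg-mv_1v_2(u_1v_1-u_2v_2)g^2\bigr)^2,\\ a_5 & = 4\bigl(mu_1u_2(u_1v_1+u_2v_2)f^2-(u_1v_2+u_2v_1)(m^2u_1u_2v_1v_2+1)fg+mv_1v_2(u_1v_1+u_2v_2)g^2\bigr)^2,\\ b_1 & = 0,\\ b_2 & = -4(u_1^2-u_2^2)(v_1^2-v_2^2)(m^2u_1^2u_2^2f^2-g^2)(f^2-m^2v_1^2v_2^2g^2),\\ b_3 & = 4(m^2u_1^2v_1^2-1)(m^2u_2^2v_2^2-1)(f^2u_1^2-g^2v_1^2)(f^2u_2^2-g^2v_2^2).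 \end{aligned} \] Then all the 15 sums $a_i+b_j$, $i=1,\ldots,5$, $j=1,2,3$, are squares of rational numbers. *)

(* Defs.v *)
From mathcomp Require Export all_boot all_order all_algebra.

Set Implicit Arguments.
Unset Strict Implicit.
Unset Printing Implicit Defensive.

(* Main.v *)
(* Put S = u1 v1 - u2 v2, D = u1 v2 - u2 v1, P = m^2 u1 u2 v1 v2 - 1 and
   al = u1 u2 f^2 - v1 v2 g^2. Then a1 = 4 (m S al - P D f g)^2, and since
     b2 = 4 (D^2 - S^2) (m^2 al^2 - P^2 f^2 g^2),
     b3 = 4 (P^2 - m^2 S^2) (al^2 - D^2 f^2 g^2),
   adding b2 swaps S and D, and adding b3 swaps m S and P, in this square.
   The substitutions g -> -g and u2 -> -u2 fix b2 and b3 and permute a1, a4, a5,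
   a2 transitively, which settles these four. For a3, the roots of a3 + b2 and
   a3 + b3 are forms c f^2 + d g^2, with c and d read off the coefficients of
   f^4 and g^4. *)
Require Import Defs.
From mathcomp Require Import all_boot all_order all_algebra.
From mathcomp Require Import ring.

Import Order.TTheory GRing.Theory Num.Theory.
Local Open Scope ring_scope.

Theorem theorem2
  (f g m u1 u2 v1 v2 : rat) (a1 a2 a3 a4 a5 b1 b2 b3 : rat)
  (ha1 : a1 = 4 * (m * u1 * u2 * (u1 * v1 - u2 * v2) * f ^+ 2
              - (u1 * v2 - u2 * v1) * (m ^+ 2 * u1 * u2 * v1 * v2 - 1) * f * g
              - m * v1 * v2 * (u1 * v1 - u2 * v2) * g ^+ 2) ^+ 2)
  (ha2 : a2 = 4 * (m * u1 * u2 * (u1 * v1 + u2 * v2) * f ^+ 2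
              + (u1 * v2 + u2 * v1) * (m ^+ 2 * u1 * u2 * v1 * v2 + 1) * f * g
              + m * v1 * v2 * (u1 * v1 + u2 * v2) * g ^+ 2) ^+ 2)
  (ha3 : a3 = ((u1 ^+ 2 * u2 ^+ 2 * (v1 ^+ 2 - v2 ^+ 2) * m ^+ 2
                + u1 ^+ 2 - u2 ^+ 2) * f ^+ 2
             - (v1 ^+ 2 * v2 ^+ 2 * (u1 ^+ 2 - u2 ^+ 2) * m ^+ 2
                + v1 ^+ 2 - v2 ^+ 2) * g ^+ 2) ^+ 2)
  (ha4 : a4 = 4 * (m * u1 * u2 * (u1 * v1 - u2 * v2) * f ^+ 2
              + (u1 * v2 - u2 * v1) * (m ^+ 2 * u1 * u2 * v1 * v2 - 1) * f * g
              - m * v1 * v2 * (u1 * v1 - u2 * v2) * g ^+ 2) ^+ 2)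
  (ha5 : a5 = 4 * (m * u1 * u2 * (u1 * v1 + u2 * v2) * f ^+ 2
              - (u1 * v2 + u2 * v1) * (m ^+ 2 * u1 * u2 * v1 * v2 + 1) * f * g
              + m * v1 * v2 * (u1 * v1 + u2 * v2) * g ^+ 2) ^+ 2)
  (hb1 : b1 = 0)
  (hb2 : b2 = - 4 * (u1 ^+ 2 - u2 ^+ 2) * (v1 ^+ 2 - v2 ^+ 2)
              * (m ^+ 2 * u1 ^+ 2 * u2 ^+ 2 * f ^+ 2 - g ^+ 2)
              * (f ^+ 2 - m ^+ 2 * v1 ^+ 2 * v2 ^+ 2 * g ^+ 2))
  (hb3 : b3 = 4 * (m ^+ 2 * u1 ^+ 2 * v1 ^+ 2 - 1)
              * (m ^+ 2 * u2 ^+ 2 * v2 ^+ 2 - 1)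
              * (f ^+ 2 * u1 ^+ 2 - g ^+ 2 * v1 ^+ 2)
              * (f ^+ 2 * u2 ^+ 2 - g ^+ 2 * v2 ^+ 2)) :
  forall (i : 'I_5) (j : 'I_3),
    exists r : rat,
      tnth [tuple a1; a2; a3; a4; a5] i + tnth [tuple b1; b2; b3] j = r ^+ 2.
Proof.
pose S := u1 * v1 - u2 * v2; pose D := u1 * v2 - u2 * v1.
pose P := m ^+ 2 * u1 * u2 * v1 * v2 - 1.
pose al := u1 * u2 * f ^+ 2 - v1 * v2 * g ^+ 2.
(* [u2 -> -u2] sends [S], [D], [P], [al] to [S'], [D'], [-P'], [-al']. *)
pose S' := u1 * v1 + u2 * v2; pose D' := u1 * v2 + u2 * v1.
pose P' := m ^+ 2 * u1 * u2 * v1 * v2 + 1.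
pose al' := u1 * u2 * f ^+ 2 + v1 * v2 * g ^+ 2.
pose U := u1 ^+ 2 - u2 ^+ 2; pose V := v1 ^+ 2 - v2 ^+ 2.
pose U' := u1 ^+ 2 + u2 ^+ 2; pose V' := v1 ^+ 2 + v2 ^+ 2.
pose p := u1 ^+ 2 * u2 ^+ 2; pose q := v1 ^+ 2 * v2 ^+ 2.
case=> [[|[|[|[|[|//]]]]] ?] [[|[|[|//]]] ?]; rewrite !(tnth_nth 0) /=;
  rewrite ?hb1 ?addr0 ?ha1 ?ha2 ?ha3 ?ha4 ?ha5 ?hb2 ?hb3.
- by exists (2 * (m * S * al - P * D * f * g)); rewrite /S /D /P /al; ring.
- by exists (2 * (m * D * al - P * S * f * g)); rewrite /S /D /P /al; ring.
- by exists (2 * (P * al - m * S * D * f * g)); rewrite /S /D /P /al; ring.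
(* Roots for [a1] under both [u2 -> -u2] and [g -> -g], up to sign. *)
- by exists (2 * (m * S' * al' + P' * D' * f * g));
    rewrite /S' /D' /P' /al'; ring.
- by exists (2 * (m * D' * al' + P' * S' * f * g));
    rewrite /S' /D' /P' /al'; ring.
- by exists (2 * (P' * al' + m * S' * D' * f * g));
    rewrite /S' /D' /P' /al'; ring.
- by eexists; reflexivity.
(* For [f^4]: [(m^2 p V + U)^2 - 4 m^2 p U V = (m^2 p V - U)^2], likewise for [g^4]; the [f^2 g^2]
   term fixes the relative sign. *)
- exists ((m ^+ 2 * p * V - U) * f ^+ 2 + (m ^+ 2 * q * U - V) * g ^+ 2).
  by rewrite /p /q /U /V; ring.
(* Here [U'^2 = U^2 + 4 p], [V'^2 = V^2 + 4 q] and [U V + U' V' = 2 (u1^2 v1^2 + u2^2 v2^2)]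
   complete the squares. *)
- exists ((m ^+ 2 * p * V' - U') * f ^+ 2 - (m ^+ 2 * q * U' - V') * g ^+ 2).
  by rewrite /p /q /U' /V'; ring.
- by exists (2 * (m * S * al + P * D * f * g)); rewrite /S /D /P /al; ring.
- by exists (2 * (m * D * al + P * S * f * g)); rewrite /S /D /P /al; ring.
- by exists (2 * (P * al + m * S * D * f * g)); rewrite /S /D /P /al; ring.
(* Roots for [a1] under [u2 -> -u2] alone, up to sign. *)
- by exists (2 * (m * S' * al' - P' * D' * f * g));
    rewrite /S' /D' /P' /al'; ring.
- by exists (2 * (m * D' * al' - P' * S' * f * g));
    rewrite /S' /D' /P' /al'; ring.
- by exists (2 * (P' * al' - m * S' * D' * f * g));
    rewrite /S' /D' /P' /al'; ring.
Qed.
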